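(* Assume that $(\Sigma,T)$ is topologically transitive, that $(\Sigma\times X,\widehat F)$ admits weak unstable holonomies and $\widehat\varphi$-holonomies, and that $\mu$ is uniformly $\widehat\varphi$-expanding on average with constant $\chi>0$. Then for all $\omega^-\in\Sigma^-$, $$\inf_{t\in X}\int\widehat\varphi\circ\widehat F^n(\omega,t)\,d\mu_{\omega^-}(\omega)\ge\chi-o_n(1),$$ and so also $$\inf_{t\in X}\int\frac1n\sum_{0\le j\le n}\widehat\varphi\circ\widehat F^j(\omega,t)\,d\mu_{\omega^-}(\omega)\ge\chi-o_n(1),$$ where $o_n(1)$ denotes a sequence (depending on $n$ only) tending to $0$ as $n\to\infty$.
   Context: Setting: $\Sigma$ is a two-sided compact (finite alphabet) topological Markov shift with left shift $T$; $X$ is a compact metric space; $\omega\mapsto F_\omega$ is a Hölder continuous map from $\Sigma$ into the space $C_\alpha(X,X)$ of $\alpha$-Hölder maps of $X$, each $F_\omega$ an $\alpha$-Hölder homeomorphism; $\widehat F(\omega,t)=(T\omega,F_\omega(t))$; $F^k_\omega=F_{T^{k-1}\omega}\circ\cdots\circ F_\omega$. $\widehat\varphi:\Sigma\times X\to\mathbb R$ is Hölder continuous and $\widehat\varphi^{(n)}:=\sum_{k=0}^{n-1}\widehat\varphi\circ\widehat F^k$. (The motivating case: $M$ a closed Riemannian manifold of dimension $\ge2$, $\omega\mapsto f_\omega\in\mathrm{Diff}^{1+\alpha}(M)$ Hölder, $X=T^1M$, $F_\omega(x,\xi)=(f_\omega(x),d_xf_\omega\xi/|d_xf_\omega\xi|)$,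 $\widehat\varphi(\omega,(x,\xi))=\log|d_xf_\omega\xi|$.) $\mu$ is a $T$-invariant Gibbs probability measure on $\Sigma$ for a Hölder potential $\psi$, normalized so that: $P(\psi)=0$ ($P$ the usual topological/Gurevich pressure); $\psi(\omega)$ depends only on $(\omega_i)_{i\le-1}$; and $L_\psi1=1$, where $(L_\psi g)(\omega^-)=\sum_{T_R\tau^-=\omega^-}e^{\psi(\tau^-)}g(\tau^-)$ on $C(\Sigma^-)$, $\Sigma^-=\{(\omega_i)_{i\le-1}:\omega\in\Sigma\}$ and $T_R$ is the right shift, which deletes the coordinate at position $-1$. For $\omega^-\in\Sigma^-$, $\mu_{\omega^-}$ is the conditional measure of $\mu$ on $V^u_{\le-1}(\omega^-)=\{\omega\in\Sigma:\omega_i=\omega^-_i\ \forall i\le-1\}$ (defined for every $\omega^-$ by $\mu_{\omega^-}([w_0,\dots,w_{n-1}])=\prod_{k=1}^{n}e^{\psi(\omega^-w_0\cdots w_{k-1})}$ for admissible continuations). Uniform $\widehat\varphi$-expansion on average with constant $\chi>0$: for every $\omega^-\in\Sigma^-$, $\inf_{t\in X}\int\widehat\varphi(\omega,t)\,d\mu_{\omega^-}(\omega)\ge\chi$. $\widehat\varphi$-holonomies: there is $C>0$ such that for all $n\ge0$, $t\in X$ and $\omega,\omega'\in\Sigma$ with $\omega_i=\omega'_i$ for $0\le i\le n$, $|\widehat\varphi^{(n)}(\omega,t)-\widehat\varphi^{(n)}(\omega',t)|\le C$. Weak unstable holonomies: $\sup_{t\in X}\ \sup_{\omega,\omega'\in\Sigma:\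 \omega_i=\omega'_i\,\forall i\le-1}d\big(F^j_{T^{-j}\omega}(t),F^j_{T^{-j}\omega'}(t)\big)\to0$ as $j\to\infty$. *)

(* Defs.v *)
From HB Require Import structures.
From mathcomp Require Import all_boot all_order all_algebra.
From mathcomp Require Import all_classical all_reals all_analysis.

Set Implicit Arguments.
Unset Strict Implicit.
Unset Printing Implicit Defensive.

Import Order.TTheory GRing.Theory Num.Theory.
Import numFieldNormedType.Exports.

Local Open Scope classical_set_scope.
Local Open Scope ring_scope.

(* [ms_point] only witnesses that the shift is nonempty (the library's
   measurable types are pointed). *)
Record markov_shift := MarkovShift {
  alphabet : finType;
  edge : rel alphabet;
  ms_point : int -> alphabet;
  ms_pointP : forall i : int, edge (ms_point i) (ms_point (i + 1))
}.

(* The parameter [R] is the field in which the metric put on the shift space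
   below takes its values. *)
Record Sigma (R : realType) (M : markov_shift) := MkSigma {
  coord :> int -> alphabet M;
  coordP : forall i : int, edge (coord i) (coord (i + 1))
}.

(* Sigma^-: the past (omega_i)_(i <= -1) is stored as the sequence
   k |-> omega_(-(k+1)). *)
Record Sminus (R : realType) (M : markov_shift) := MkSminus {
  ncoord :> nat -> alphabet M;
  ncoordP : exists w : Sigma R M, forall k : nat, ncoord k = w (- k.+1%:Z)
}.

HB.instance Definition _ R M := gen_eqMixin (Sigma R M).
HB.instance Definition _ R M := gen_choiceMixin (Sigma R M).
HB.instance Definition _ R M :=
  isPointed.Build (Sigma R M) (MkSigma R (@ms_pointP M)).
HB.instance Definition _ R M := gen_eqMixin (Sminus R M).
HB.instance Definition _ R M := gen_choiceMixin (Sminus R M).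

Section SymbolicSpace.
Context {R : realType} {M : markov_shift}.
Local Notation Sg := (Sigma R M).
Local Notation Sm := (Sminus R M).
Implicit Types (v w : Sg) (x y : Sm).

Lemma Sigma_ext v w : (forall i, v i = w i) -> v = w.
Proof.
case: v w => [v vP] [w wP] /= vw; have {}vw : v = w by apply/funext.
by case: _ / vw in wP *; congr MkSigma; exact: Prop_irrelevance.
Qed.

Lemma Sminus_ext x y : (forall k, x k = y k) -> x = y.
Proof.
case: x y => [x xP] [y yP] /= xy; have {}xy : x = y by apply/funext.
by case: _ / xy in yP *; congr MkSminus; exact: Prop_irrelevance.
Qed.

Definition diff_weights v w : set R :=
  [set 2^-1 ^+ absz i | i in [set i : int | v i <> w i]].

(* 2 ^ - min {|i| : v_i <> w_i}, and 0 if v = w (as [sup set0 = 0]). *)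
Definition sdist v w : R := sup (diff_weights v w).

Lemma diff_weights_ub v w : has_ubound (diff_weights v w).
Proof.
exists 1 => _ [i _ <-]; rewrite exprn_ile1 ?invr_ge0// invf_le1 ?ler1n//.
Qed.

Lemma sdist_ge v w i : v i <> w i -> 2^-1 ^+ absz i <= sdist v w.
Proof. by move=> vwi; apply: (ub_le_sup (diff_weights_ub v w)); exists i. Qed.

Lemma sdist_ge0 v w : 0 <= sdist v w.
Proof.
have [[i vwi]|nvw] := pselect (exists i, v i <> w i).
  by rewrite (le_trans _ (sdist_ge vwi))// exprn_ge0// invr_ge0.
rewrite /sdist; suff -> : diff_weights v w = set0 by rewrite sup0.
by rewrite -subset0 => t [i vwi _]; apply: nvw; exists i.
Qed.

Lemma sdistxx v : sdist v v = 0.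
Proof.
rewrite /sdist; suff -> : diff_weights v v = set0 by rewrite sup0.
by rewrite -subset0 => t [i vvi _]; exact: vvi.
Qed.

Lemma sdist_positivity v w : sdist v w = 0 -> v = w.
Proof.
move=> vw0; apply: Sigma_ext => i; apply: contrapT => /sdist_ge.
by rewrite vw0 leNgt exprn_gt0// invr_gt0.
Qed.

Lemma sdist_sym v w : sdist v w = sdist w v.
Proof.
rewrite /sdist; congr sup.
by apply/seteqP; split => _ [i vwi <-]; exists i => //; apply: nesym.
Qed.

Lemma sdist_triangle w v u : sdist v u <= sdist v w + sdist w u.
Proof.
have [[i vui]|nvu] := pselect (exists i, v i <> u i); last first.
  have -> : v = u by apply: Sigma_ext => i; apply: contrapT => ?; apply: nvu; exists i.
  by rewrite sdistxx addr_ge0 ?sdist_ge0.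
apply: ge_sup; first by exists (2^-1 ^+ absz i), i.
move=> _ [j vuj <-]; have [vwj|vwj] := pselect (v j = w j).
  by rewrite ler_wpDl ?sdist_ge0// sdist_ge// -vwj.
by rewrite ler_wpDr ?sdist_ge0// sdist_ge.
Qed.

HB.instance Definition _ := @isMetric.Build R (Sigma R M)
  sdist sdistxx sdist_positivity sdist_sym sdist_triangle.

(* Borel sigma-algebra *)
HB.instance Definition _ := @isMeasurable.Build (sigma_display (@open (Sigma R M)))
  (Sigma R M) <<s @open (Sigma R M) >> (@sigma_algebra0 _ setT _)
  (@sigma_algebraC (Sigma R M) _) (@sigma_algebra_bigcup _ setT _).

Lemma shift_subproof w (i : int) : edge (w (i + 1)) (w (i + 1 + 1)).
Proof. exact: coordP. Qed.

Definition shiftT w : Sg := MkSigma R (shift_subproof w).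

Lemma shiftV_subproof w (i : int) : edge (w (i - 1)) (w (i + 1 - 1)).
Proof. by rewrite addrAC; exact: coordP. Qed.

Definition shiftTV w : Sg := MkSigma R (shiftV_subproof w).

Lemma past_subproof w :
  exists v : Sg, forall k : nat, w (- k.+1%:Z) = v (- k.+1%:Z).
Proof. by exists w. Qed.

Definition past w : Sm := MkSminus (past_subproof w).

Lemma del_last_subproof x :
  exists w : Sg, forall k : nat, x k.+1 = w (- k.+1%:Z).
Proof.
have [w xw] := ncoordP x; exists (shiftTV w) => k; rewrite xw /=.
by congr (w _); rewrite -opprD -PoszD addn1.
Qed.

(* T_R: deletes the coordinate at position -1 *)
Definition del_last x : Sm := MkSminus (del_last_subproof x).

(* V^u_{<= -1} *)
Definition Vu x : set Sg := [set w | past w = x].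

Definition same_past v w := forall i : int, i <= -1 -> v i = w i.

(* the cylinder [w_0, ..., w_{n-1}] *)
Definition cylinder w (n : nat) : set Sg :=
  [set v | forall i : nat, (i < n)%N -> v i%:Z = w i%:Z].

Definition topologically_transitive :=
  forall U V : set Sg, open U -> open V -> U !=set0 -> V !=set0 ->
    exists n : nat, (iter n shiftT @` U) `&` V !=set0.

Definition birkhoff (psi : Sg -> R) (n : nat) w : R :=
  \sum_(0 <= k < n) psi (iter k shiftT w).

(* Words without admissible extension contribute [sup set0 = 0]. *)
Definition partition_function (psi : Sg -> R) (n : nat) : R :=
  \sum_(a : n.-tuple (alphabet M))
    sup [set expR (birkhoff psi n w) | w in
           [set w : Sg | forall i : 'I_n, w (i : nat)%:Z = tnth a i]].

Definition pressure (psi : Sg -> R) : R :=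
  limn (fun n : nat => ln (partition_function psi n) / n%:R).

Definition shift_invariant (mu : probability Sg R) :=
  forall B : set Sg, measurable B -> mu (shiftT @^-1` B) = mu B.

Definition gibbs (psi : Sg -> R) (mu : probability Sg R) :=
  exists2 K : R, 0 < K & forall w (n : nat),
    let e := expR (birkhoff psi n w - n%:R * pressure psi) in
    ((K^-1 * e)%:E <= mu (cylinder w n) <= (K * e)%:E)%E.

(* The sum is over a finite set: a past has at most #|alphabet M| preimages
   under [del_last]. *)
Definition transfer (psim : Sm -> R) (g : Sm -> R) x : R :=
  \sum_(y \in [set y | del_last y = x]) expR (psim y) * g y.

(* For w in V^u(x), the past of T^(k+1) w is the concatenation x w_0 ... w_k,
   so that the product below is that of e^psi(x w_0 ... w_(k-1)), 1 <= k <= n. *)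
Definition conditional_measures (psim : Sm -> R) (mu : probability Sg R)
    (muc : Sm -> probability Sg R) :=
  [/\ forall x, muc x (Vu x) = 1%E,
      forall x w (n : nat), Vu x w ->
        muc x (cylinder w n) =
          (\prod_(0 <= k < n) expR (psim (past (iter k.+1 shiftT w))))%:E
    & forall B : set Sg, measurable B ->
        (mu B = \int[mu]_w muc (past w) B)%E].

End SymbolicSpace.

Definition holder_exp {R : realType} {U V : Type} (dU : U -> U -> R)
    (dV : V -> V -> R) (a : R) (f : U -> V) :=
  exists C : R, forall x y, dV (f x) (f y) <= C * dU x y `^ a.

Definition holder {R : realType} {U V : Type} (dU : U -> U -> R)
    (dV : V -> V -> R) (f : U -> V) :=
  exists2 a : R, 0 < a <= 1 & holder_exp dU dV a f.

Definition homeomorphism {U V : topologicalType} (f : U -> V) :=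
  continuous f /\
  exists g : V -> U, [/\ continuous g, cancel f g & cancel g f].

Section SkewProduct.
Context {R : realType} {M : markov_shift} {X : metricType R}.
Local Notation Sg := (Sigma R M).
Local Notation Sm := (Sminus R M).

Definition rdist (a b : R) : R := `|a - b|.

Definition prod_dist (p q : Sg * X) : R :=
  Num.max (mdist p.1 q.1) (mdist p.2 q.2).

Definition unif_dist (f g : X -> X) : R :=
  sup [set mdist (f t) (g t) | t in [set: X]].

(* Hölder continuity of w |-> F w is with respect to the uniform distance on
   C_alpha(X, X): for a general metric space X there is no Hölder seminorm of a
   difference, and any finer Hölder-type distance gives a stronger hypothesis. *)
Definition holder_cocycle (alpha : R) (F : Sg -> X -> X) :=
  [/\ 0 < alpha <= 1,
      forall w, holder_exp mdist mdist alpha (F w) /\ homeomorphism (F w)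
    & holder mdist unif_dist F].

Definition skew_map (F : Sg -> X -> X) (p : Sg * X) : Sg * X :=
  (shiftT p.1, F p.1 p.2).

(* F^k_w = F_(T^(k-1) w) o ... o F_w *)
Fixpoint cocycle (F : Sg -> X -> X) (k : nat) (w : Sg) (t : X) : X :=
  if k is j.+1 then F (iter j shiftT w) (cocycle F j w t) else t.

Definition skew_birkhoff (F : Sg -> X -> X) (phi : Sg * X -> R) (n : nat)
    (p : Sg * X) : R :=
  \sum_(0 <= k < n) phi (iter k (skew_map F) p).

Definition expanding_on_average (phi : Sg * X -> R)
    (muc : Sm -> probability Sg R) (chi : R) :=
  forall x : Sm,
    (chi%:E <= ereal_inf [set \int[muc x]_w (phi (w, t))%:E | t in [set: X]])%E.

Definition phi_holonomies (F : Sg -> X -> X) (phi : Sg * X -> R) :=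
  exists2 C : R, 0 < C &
    forall (n : nat) (t : X) (v w : Sg),
      (forall i : nat, (i <= n)%N -> v i%:Z = w i%:Z) ->
      `|skew_birkhoff F phi n (v, t) - skew_birkhoff F phi n (w, t)| <= C.

Definition weak_unstable_holonomies (F : Sg -> X -> X) :=
  (fun j : nat => sup [set d : R | exists (t : X) (v w : Sg), same_past v w /\
     d = mdist (cocycle F j (iter j shiftTV v) t)
               (cocycle F j (iter j shiftTV w) t)]) @ \oo --> (0 : R).

End SkewProduct.

(* Main.v *)
(* Disintegrate muc x over the n-cylinders [w_0 ... w_(n-1)] meeting Vu x. On each
   of them the image of muc x under T^n is a multiple of the conditional measure
   at y = x w_0 ... w_(n-1), and all the points T^n v obtained share the past y,
   so that by weak unstable holonomies F^n_v(t) is uniformly close to a constant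
   s. Up to a uniform error, the integral of phi o F^n over the cylinder is thus
   muc x of the cylinder times the integral of phi(., s) for muc y, which is at
   least chi. The averaged bound follows by Cesaro summation. *)

Require Import Defs.
From HB Require Import structures.
From mathcomp Require Import all_boot all_order all_algebra.
From mathcomp Require Import all_classical all_reals all_analysis.
From mathcomp Require Import measurable_realfun zify lra.

Set Implicit Arguments.
Unset Strict Implicit.
Unset Printing Implicit Defensive.

Import Order.TTheory GRing.Theory Num.Theory.
Import numFieldNormedType.Exports.

Local Open Scope classical_set_scope.
Local Open Scope ring_scope.

(** * Windows and Borel sets of the shift space *)

Section Symbolic.
Context {R : realType} {M : markov_shift}.
Local Notation Sg := (Sigma R M).
Local Notation Sm := (Sminus R M).
Implicit Types (v w : Sg) (x y : Sm).

Lemma iter_shiftTE n w (i : int) : iter n shiftT w i = w (i + n%:Z).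
Proof.
elim: n i => [|n IHn] i; first by rewrite addr0.
by rewrite iterS /= IHn; congr (w _); lia.
Qed.

Lemma iter_shiftTVE n w (i : int) : iter n shiftTV w i = w (i - n%:Z).
Proof.
elim: n i => [|n IHn] i; first by rewrite subr0.
by rewrite iterS /= IHn; congr (w _); lia.
Qed.

Lemma iter_shiftTK n : cancel (iter n (@shiftT R M)) (iter n shiftTV).
Proof.
by move=> w; apply: Sigma_ext => i; rewrite iter_shiftTVE iter_shiftTE subrK.
Qed.

Lemma iter_shiftTVK n : cancel (iter n (@shiftTV R M)) (iter n shiftT).
Proof.
by move=> w; apply: Sigma_ext => i; rewrite iter_shiftTE iter_shiftTVE addrK.
Qed.

Lemma eq_pastP v w : past v = past w <-> same_past v w.
Proof.
split=> [vw i i_lt0|vw]; last by apply: Sminus_ext => k; apply: vw; lia.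
have -> : i = - (absz i).-1.+1%:Z by lia.
by have := congr1 (fun x : Sm => x (absz i).-1) vw.
Qed.

(** A coordinate of [T^k v] at [i <= -1] is the coordinate of [v] at [i + k < n], which lies either
    in the common past or among the [n] common letters. *)
Lemma past_iter_shiftT n v w k : (k <= n)%N -> past v = past w ->
  cylinder w n v -> past (iter k shiftT v) = past (iter k shiftT w).
Proof.
move=> kn /eq_pastP vw cv; apply/eq_pastP => i i_lt0; rewrite !iter_shiftTE.
have [|ik_ge0] := leP (i + k%:Z) (- 1); first exact: vw.
have -> : i + k%:Z = (absz (i + k%:Z))%:Z by lia.
by apply: cv; lia.
Qed.

(** The half-open range [[-m, m)] makes the nonnegative half of a window a cylinder of length [m],
    and the window of radius [0] the whole space. *)
Definition window v m : set Sg :=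
  [set w | forall i : int, - m%:Z <= i < m%:Z -> w i = v i].

Lemma windowxx v m : window v m v. Proof. by []. Qed.

Lemma sub_window v m m' : (m <= m')%N -> window v m' `<=` window v m.
Proof. by move=> mm w vw i im; apply: vw; lia. Qed.

Lemma window_eq v w m : window v m w -> window w m = window v m.
Proof.
by move=> vw; apply/seteqP; split => u uw i im; rewrite uw// vw.
Qed.

(** Points that differ at [i] are at distance at least [2^-|i|], so the open ball of radius [2^-m]
    lies in the window of radius [m]; conversely that window stays within distance [2^-m] of its
    centre. *)
Lemma open_windowP (A : set Sg) :
  open A <-> forall w, A w -> exists m, window w m `<=` A.
Proof.
split=> [oA w Aw|Am]; last first.
  rewrite openE => w /[dup] Aw /Am[m wA]; apply/nbhs_ballP.
  exists (2^-1 ^+ m); first by rewrite /= exprn_gt0// invr_gt0.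
  move=> v; rewrite ballEmdist /= => wv; apply: wA => i im.
  apply: contrapT => /nesym/(sdist_ge (R := R)) /le_lt_trans/(_ wv).
  by rewrite ltr_iXn2l ?invr_gt0 ?invf_lt1 ?ltr1n//; lia.
have /nbhs_ballP[e /= e0 wA] := open_nbhs_nbhs (conj oA Aw).
have [m me] : exists m, 2^-1 ^+ m < e :> R.
  have /cvgrPdist_lt/(_ _ e0)[m _ /(_ m)] : (2^-1 ^+ k : R) @[k --> \oo] --> 0.
    by apply: cvg_expr; rewrite ger0_norm ?invr_ge0// invf_lt1// ltr1n.
  by rewrite sub0r normrN => /(_ (leqnn _))/ltr_normlW; exists m.
exists m => v wv; apply: wA; rewrite ballEmdist /=; apply: le_lt_trans me.
have [[i wvi]|nwv] := pselect (exists i, w i <> v i); last first.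
  have -> : w = v.
    by apply: Sigma_ext => i; apply: contrapT => ?; apply: nwv; exists i.
  by rewrite mdistxx exprn_ge0// invr_ge0.
apply: ge_sup; first by exists (2^-1 ^+ absz i), i.
move=> _ [j wvj <-]; rewrite ler_wiXn2l ?invr_ge0 ?invf_le1 ?ler1n//.
by rewrite leqNgt; apply/negP => jm; apply: wvj; rewrite wv//; lia.
Qed.

Lemma continuous_iter_shiftT n : continuous (iter n (@shiftT R M)).
Proof.
apply/continuousP => A /open_windowP oA; apply/open_windowP => w /= /oA[m wA].
exists (m + n)%N => v wv; apply: wA => i im.
by rewrite !iter_shiftTE wv//; lia.
Qed.

Lemma measurable_open (U : set Sg) : open U -> measurable U.
Proof. exact: sub_sigma_algebra. Qed.

Lemma measurable_window v m : measurable (window v m).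
Proof.
apply: measurable_open; apply/open_windowP => w vw.
by exists m; rewrite (window_eq vw).
Qed.

Lemma measurable_cylinder w n : measurable (cylinder w n).
Proof.
apply: measurable_open; apply/open_windowP => v wv; exists n => u vu i im.
by rewrite -wv// vu//; lia.
Qed.

Lemma measurable_Vu x : measurable (Vu x).
Proof.
have -> : Vu x = \bigcap_(k : nat) [set w | w (- k.+1%:Z) = x k].
  apply/seteqP; split => [w <- k _ //|w wx].
  by apply: Sminus_ext => k; exact: wx.
apply: bigcapT_measurable => k.
apply: measurable_open; apply/open_windowP => w wk; exists k.+1 => v vw /=.
by rewrite -wk vw//; lia.
Qed.

Definition windows : set (set Sg) :=
  [set A | A = set0 \/ exists v m, A = window v m].

(** Two windows that meet at [u] are both windows around [u], hence nested. This pi-system serves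
    for the uniqueness of measures in [muc_cylinder]. *)
Lemma setI_closed_windows : setI_closed windows.
Proof.
move=> A B [->|[v [m ->]]]; first by rewrite set0I; left.
move=> [->|[w [k ->]]]; first by rewrite setI0; left.
have [[u [uv uw]]|nu] := pselect (window v m `&` window w k !=set0); last first.
  by left; exact/nonemptyPn.
right; exists u, (maxn m k); rewrite -(window_eq uv) -(window_eq uw).
apply/seteqP; split => [t [tm tk] i im|t tu].
  by have [mk|mk] := leqP m k; [apply: tk|apply: tm]; lia.
by split; apply: sub_window tu; rewrite ?leq_maxl ?leq_maxr.
Qed.

(* The alphabet is finite, so an open set is a countable union of windows: they
   are enumerated by the words that they determine. *)
Lemma measurable_windowsE : measurable = <<s windows >> :> set (set Sg).
Proof.
apply/seteqP; split; last first.
  apply: smallest_sub; first exact: sigma_algebra_measurable.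
  by move=> A [->|[v [m ->]]]; [exact: measurable0|exact: measurable_window].
apply: smallest_sub; first exact: smallest_sigma_algebra.
move=> U oU.
pose word w m := [seq w (i%:Z - m%:Z) | i <- iota 0 m.*2].
(* A word over [[-m, m)] has length [2m], so the radius is read off the word. [D s] is the window
   spelled by [s] if it lies in [U], and empty otherwise; hence the default [[::]] for a failed
   [unpickle] adds nothing outside [U]. *)
pose D (s : seq (alphabet M)) :=
  [set w | window w (size s)./2 `<=` U /\ word w (size s)./2 = s].
have word_window w v m : word v m = word w m -> window w m v.
  move=> vw i im; have := congr1 (fun s => nth (w i) s (absz (i + m%:Z))) vw.
  rewrite !(nth_map 0%N) ?size_iota ?nth_iota; try lia.
  by have -> : (0 + absz (i + m%:Z)%R)%N%:Z - m%:Z = i by lia.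
have wordD w m : window w m `<=` U -> D (word w m) w.
  by move=> wU; rewrite /D /= size_map size_iota doubleK.
have -> : U = \bigcup_k D (odflt [::] (unpickle k)).
  apply/seteqP; split => [w Uw|w [k _]].
    have [m wU] := (open_windowP U).1 oU w Uw.
    by exists (pickle (word w m)) => //; rewrite pickleK; exact: wordD.
  by move=> [wU _]; apply: wU; exact: windowxx.
apply: (@sigma_algebra_bigcup _ setT) => k; move: (odflt _ _) => s.
apply: sub_sigma_algebra; have [[v Dv]|nD] := pselect (D s !=set0); last first.
  by left; exact/nonemptyPn.
right; exists v, (size s)./2; have [vU sv] := Dv; apply/seteqP; split => w.
  by move=> [_ sw]; apply: word_window; rewrite sw sv.
move=> vw; split; first by rewrite (window_eq vw).
rewrite -[RHS]sv; apply/eq_in_map => i; rewrite mem_iota => im.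
by apply: vw; lia.
Qed.

End Symbolic.

(** * Integrals of bounded functions against a probability *)

Lemma integral_probability_cst {d} {T : measurableType d} {R : realType}
  (P : probability T R) (c : \bar R) : (\int[P]_(t in setT) cst c t = c)%E.
Proof.
by rewrite integral_cst// -[RHS]mule1; congr (_ * _)%E; exact: probability_setT.
Qed.

Lemma bounded_integrable {d} {T : measurableType d} {R : realType}
    (P : probability T R) (g : T -> R) (K : R) :
  measurable_fun [set: T] g -> (forall t, `|g t| <= K) ->
  P.-integrable [set: T] (fun t => (g t)%:E).
Proof.
move=> mg gK; apply: measurable_bounded_integrable => //.
  by rewrite -ge0_fin_numE// fin_num_measure.
by exists K; split; [exact: num_real|move=> r Kr t _; exact: le_trans (ltW Kr)].
Qed.

Lemma integralD_cst {d} {T : measurableType d} {R : realType}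
    (P : probability T R) (g : T -> R) (K c : R) :
  measurable_fun [set: T] g -> (forall t, `|g t| <= K) ->
  (\int[P]_t (g t + c)%:E = \int[P]_t (g t)%:E + c%:E)%E.
Proof.
move=> mg gK; have gi := bounded_integrable P mg gK.
have ci : P.-integrable setT (EFin \o cst c).
  exact: finite_measure_integrable_cst.
have /= := integralD_EFin (measurableT) gi ci.
by rewrite integral_probability_cst.
Qed.

(** * Conditional measures under iterates of the shift *)

Section Conditional.
Context {R : realType} {M : markov_shift}.
Local Notation Sg := (Sigma R M).
Local Notation Sm := (Sminus R M).
Implicit Types (v w : Sg) (x y : Sm).

Lemma measurable_iter_shiftT n : measurable_fun [set: Sg] (iter n shiftT).
Proof.
apply: (measurability (@open Sg)); first by [].
move=> _ [A oA <-]; rewrite setTI; apply: measurable_open.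
by have /continuousP := @continuous_iter_shiftT R M n; exact.
Qed.

Variables (psim : Sm -> R) (mu : probability Sg R).
Variable muc : Sm -> probability Sg R.
Hypothesis mucP : conditional_measures psim mu muc.

Let muc_Vu x : muc x (Vu x) = 1%E. Proof. by have [] := mucP. Qed.

Lemma muc_notin_Vu x : muc x (~` Vu x) = 0%E.
Proof.
by rewrite probability_setC ?muc_Vu ?subee//; exact: measurable_Vu.
Qed.

Lemma muc_setI_Vu x (A : set Sg) : measurable A ->
  muc x A = muc x (A `&` Vu x).
Proof.
move=> mA; have mV := @measurable_Vu R M x.
rewrite (measureDI (muc x) mA mV)//.
rewrite [X in (X + _)%E = _](_ : _ = 0%E) ?add0e//.
by apply: (subset_measure0 _ _ _ (muc_notin_Vu x));
  [exact: measurableD|exact: measurableC|move=> w []].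
Qed.

(** Since [muc x] is carried by [Vu x], a window or a preimage can be traded for a cylinder with the
    same trace there, whose measure is explicit. *)
Lemma muc_eq_Vu x (A B : set Sg) : measurable A -> measurable B ->
  A `&` Vu x = B `&` Vu x -> muc x A = muc x B.
Proof. by move=> mA mB AB; rewrite muc_setI_Vu// AB -muc_setI_Vu. Qed.

(** If the window is incompatible with the past [y], both sides vanish. Otherwise both sides are
    measures of cylinders, and the product formula for the word of length [n + m] splits after its
    first [n] letters. *)
Lemma muc_cylinder_window x w n v m : Vu x w ->
  muc x (cylinder w n `&` iter n shiftT @^-1` window v m) =
  (muc x (cylinder w n) * muc (past (iter n shiftT w)) (window v m))%E.
Proof.
move=> xw; set y := past _.
have mE : measurable (cylinder w n `&` iter n shiftT @^-1` window v m).
  apply: measurableI; first exact: measurable_cylinder.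
  by rewrite -[X in measurable X]setTI; apply: measurable_iter_shiftT => //;
    exact: measurable_window.
have shift_Vu u : Vu x u -> cylinder w n u -> Vu y (iter n shiftT u).
  by rewrite -xw => xu wu; exact: past_iter_shiftT wu.
have [[u [uv yu]]|nu] := pselect (window v m `&` Vu y !=set0); last first.
  rewrite (@muc_eq_Vu x _ set0)//; last first.
    rewrite set0I -subset0 => u [[wu vu] xu]; apply: nu.
    by exists (iter n shiftT u); split=> //; exact: shift_Vu.
  rewrite (@muc_eq_Vu y _ set0) ?measure0 ?mule0//.
    exact: measurable_window.
  by rewrite set0I -subset0 => u vu; apply: nu; exists u.
(* [t] realizes the concatenation: it has past [x], begins with the letters of [w], and continues
   with those of [u]. *)
pose t := iter n shiftTV u.
have tu : iter n shiftT t = u by rewrite iter_shiftTVK.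
have yuE : same_past u (iter n shiftT w) by exact/eq_pastP.
have wt : cylinder w n t.
  move=> i i_n.
  by rewrite /t iter_shiftTVE yuE ?iter_shiftTE; [congr (w _)|]; lia.
have xt : Vu x t.
  rewrite -xw; apply/eq_pastP => i i0.
  by rewrite /t iter_shiftTVE yuE ?iter_shiftTE; [congr (w _)|]; lia.
have -> : muc y (window v m) = muc y (cylinder u m).
  apply: muc_eq_Vu; [exact: measurable_window|exact: measurable_cylinder|].
  apply/seteqP; split => s [].
    by move=> vs ys; split=> // i im; rewrite vs ?uv//; lia.
  move=> us ys; split=> // i im; have [i_lt0|i_ge0] := leP i (- 1).
    by rewrite -uv//; apply: (eq_pastP _ _).1 i_lt0; rewrite ys yu.
  have -> : i = (absz i)%:Z by lia.
  by rewrite us -?uv//; lia.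
have -> : muc x (cylinder w n `&` iter n shiftT @^-1` window v m) =
          muc x (cylinder t (n + m)).
  apply: muc_eq_Vu => //; first exact: measurable_cylinder.
  apply/seteqP; split => s [].
    move=> [ws vs] xs; split=> // i im; have [i_n|n_i] := ltnP i n.
      by rewrite ws// wt.
    have := vs (i%:Z - n%:Z); rewrite /= iter_shiftTE subrK => ->; last by lia.
    by rewrite -uv ?/t ?iter_shiftTVE//; lia.
  move=> ts xs; have ws : cylinder w n s by move=> i i_n; rewrite ts ?wt//; lia.
  split=> //; split=> // i im; have [i_lt0|i_ge0] := leP i (- 1).
    rewrite -uv//; apply: (eq_pastP _ _).1 i_lt0.
    by rewrite (shift_Vu _ xs ws) yu.
  rewrite /= iter_shiftTE; have -> : i + n%:Z = (absz i + n)%N%:Z by lia.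
  rewrite ts; last by lia.
  by rewrite /t iter_shiftTVE -uv//; congr (u _); lia.
have [_ cylE _] := mucP; rewrite (cylE x t)// (cylE x w)// (cylE y u)//.
(* The first [n] factors see only [x] and letters shared by [t] and [w]; the others, reindexed by
   [n], are those of [u = T^n t]. *)
rewrite (big_cat_nat _ (leq_addr m n))//= EFinM; congr (_ * _)%E; congr (_%:E).
  apply: eq_big_nat => k kn; congr (expR (psim _)).
  by apply: (@past_iter_shiftT _ _ n t w k.+1); rewrite // xt xw.
rewrite -{1}[n]add0n big_addn addKn; apply: eq_bigr => k _.
by rewrite -iterS -addSn iterD tu.
Qed.

(* Conditionally on the letters w_0 ... w_(n-1), the image under T^n of the
   conditional measure at x is the one at the concatenation x w_0 ... w_(n-1). *)
Lemma muc_cylinder x w n (B : set Sg) : Vu x w -> measurable B ->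
  muc x (cylinder w n `&` iter n shiftT @^-1` B) =
  (muc x (cylinder w n) * muc (past (iter n shiftT w)) B)%E.
Proof.
move=> xw mB; set y := past _.
have mT := @measurable_iter_shiftT n; have mw := measurable_cylinder w n.
have p0 : 0 <= fine (muc x (cylinder w n)) by rewrite fine_ge0.
have pE : (fine (muc x (cylinder w n)))%:E = muc x (cylinder w n).
  by rewrite fineK// fin_num_measure.
pose m1 : measure Sg R := pushforward (mrestr (muc x) mw) (iter n shiftT).
pose m2 : measure Sg R := mscale (NngNum p0) (muc y).
suff : m1 mT B = m2 B.
  by rewrite /m1 /m2 /= /pushforward /mrestr /mscale/= pE setIC.
(* Both measures are finite and agree on the pi-system of windows; the whole space, being a window
   of radius [0], is the exhausting sequence. *)
apply: (@measure_unique _ _ _ windows (fun=> [set: Sg])) => //.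
- exact: measurable_windowsE.
- exact: setI_closed_windows.
- move=> _; right; exists w, 0%N; apply/seteqP; split => // v _ i; lia.
- by rewrite bigcup_const.
- move=> _ [->|[v [m ->]]]; first by rewrite !measure0.
  rewrite /m1 /m2 /= /pushforward /mrestr /mscale/= pE setIC.
  exact: muc_cylinder_window.
- move=> _; rewrite /m1 /= /pushforward /mrestr preimage_setT setTI.
  by rewrite -pE ltry.
Qed.

(** Change of variables: by [muc_cylinder], the restriction of [muc x] to the cylinder is pushed by
    [T^n] to a multiple of [muc y]. *)
Lemma integral_muc_cylinder x w n (h : Sg -> \bar R) : Vu x w ->
  measurable_fun [set: Sg] h -> (forall v, 0 <= h v)%E ->
  (\int[muc x]_(v in cylinder w n) h (iter n shiftT v) =
   muc x (cylinder w n) * \int[muc (past (iter n shiftT w))]_v h v)%E.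
Proof.
move=> xw mh h0; set y := past _.
have mT := @measurable_iter_shiftT n; have mw := measurable_cylinder w n.
have p0 : 0 <= fine (muc x (cylinder w n)) by rewrite fine_ge0.
have pE : (fine (muc x (cylinder w n)))%:E = muc x (cylinder w n).
  by rewrite fineK// fin_num_measure.
pose nu : measure Sg R := mrestr (muc x) mw.
transitivity (\int[nu]_v h (iter n shiftT v))%E.
  rewrite (@ge0_negligible_integral _ _ _ nu setT (~` cylinder w n))//.
  - rewrite setTD setCK; apply: eq_measure_integral => A mA Aw.
    by rewrite /nu/= /mrestr (setIidl Aw).
  - exact: measurableC.
  - exact: measurableT_comp.
  - by rewrite /nu/= /mrestr setICl measure0.
rewrite -(@ge0_integral_pushforward _ _ _ _ _ _ mT nu setT)//.
rewrite -[in RHS]pE -(@ge0_integral_mscale _ _ _ _ setT _ (NngNum p0))//.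
apply: eq_measure_integral => A mA _.
by rewrite /= /pushforward /nu/= /mrestr /mscale/= pE setIC muc_cylinder.
Qed.

(** The summation over cylinders in abstract form: the minorant [h] may change with the cylinder,
    and is integrated against the conditional measure reached after [n] shifts. *)
Lemma integral_muc_ge x n (G : Sg -> R) (K eps c : R) : 0 <= c -> 0 <= eps ->
  measurable_fun [set: Sg] G -> (forall w, `|G w| <= K) ->
  (forall w, Vu x w -> exists h : Sg -> R,
    [/\ measurable_fun [set: Sg] h, forall v, `|h v| <= K,
      (c%:E <= \int[muc (past (iter n shiftT w))]_v (h v)%:E)%E &
      forall v, Vu x v -> cylinder w n v -> h (iter n shiftT v) <= G v + eps]) ->
  ((c - eps)%:E <= \int[muc x]_w (G w)%:E)%E.
Proof.
move=> c0 eps0 mG GK Gh.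
have K0 : 0 <= K by exact: le_trans (normr_ge0 _) (GK (point : Sg)).
(* Adding [K] makes [G + eps] and every [h] nonnegative, so that integrals split over cylinders
   without integrability conditions. *)
have GeK0 w : 0 <= G w + (eps + K).
  by rewrite addrCA addr_ge0//; move: (GK w); rewrite ler_norml; lra.
suff : ((c + K)%:E <= \int[muc x]_w (G w + (eps + K))%:E)%E.
  rewrite (@integralD_cst _ _ _ (muc x) G K)// => cG.
  rewrite -(@leeD2rE _ (eps + K)%:E)//; apply: le_trans cG.
  by rewrite -EFinD lee_fin; lra.
(* All words of length [n] serve as a finite index set; inadmissible ones give empty sets. *)
pose E (a : {ffun 'I_n -> alphabet M}) : set Sg :=
  [set w | forall i : 'I_n, w (i : nat)%:Z = a i].
have EE a w : E a w -> E a = cylinder w n.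
  move=> aw; apply/seteqP; split => v.
    by move=> av i i_n; rewrite (av (Ordinal i_n)) (aw (Ordinal i_n)).
  by move=> wv i; rewrite wv// aw.
have mE a : measurable (E a).
  have [[w /EE ->]|/nonemptyPn ->] := pselect (E a !=set0).
    exact: measurable_cylinder.
  exact: measurable0.
have Utriv : trivIset [set` index_enum {ffun 'I_n -> alphabet M}] E.
  apply/trivIsetP => a b _ _ ab; apply/eqP; rewrite -[_ == _]negbK.
  apply: contraNN ab => /set0P[w [aw bw]]; apply/eqP/ffunP => i.
  by rewrite -aw -bw.
have UT : \big[setU/set0]_a E a = [set: Sg].
  rewrite -bigcup_seq; apply/seteqP; split => // w _.
  exists [ffun i : 'I_n => w (i : nat)%:Z] => //= [|i]; last by rewrite ffunE.
  exact: mem_index_enum.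
rewrite -[leLHS](integral_probability_cst (muc x)).
have mG' : measurable_fun [set: Sg] (fun w => (G w + (eps + K))%:E).
  by apply/measurable_EFinP/measurable_funD.
have cK0 : (0 <= (c + K)%:E)%E by rewrite lee_fin addr_ge0.
have integralE (f : Sg -> \bar R) : measurable_fun [set: Sg] f ->
    (forall w, 0 <= f w)%E ->
    (\int[muc x]_w f w = \sum_a \int[muc x]_(w in E a) f w)%E.
  move=> mf f0; rewrite -{1}UT ge0_integral_bigsetU ?UT//.
  exact: index_enum_uniq.
rewrite !integralE//; apply: lee_sum => a _.
(* A cylinder that misses [Vu x] is null for [muc x], and the constant contributes nothing on it. *)
have [[w [aw xw]]|na] := pselect (E a `&` Vu x !=set0); last first.
  rewrite integral_cst// [X in (_ * X)%E](_ : _ = 0%E).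
    by rewrite mule0; apply: integral_ge0 => w _; rewrite lee_fin.
  rewrite -(measure0 (muc x)); apply: muc_eq_Vu => //; rewrite set0I.
  exact/nonemptyPn.
rewrite (EE a w aw); have mw := measurable_cylinder w n.
have [h [mh hK ch hG]] := Gh w xw.
have hK0 v : (0 <= (h v + K)%:E)%E.
  by rewrite lee_fin; move: (hK v); rewrite ler_norml; lra.
have mhK : measurable_fun [set: Sg] (fun v => (h v + K)%:E).
  by apply/measurable_EFinP/measurable_funD.
apply: (@le_trans _ _
    (\int[muc x]_(v in cylinder w n) (h (iter n shiftT v) + K)%:E)%E).
  have /= -> := @integral_muc_cylinder x w n _ xw mhK hK0.
  rewrite integral_cst// muleC lee_wpmul2l//.
  by rewrite (@integralD_cst _ _ _ _ h K)// EFinD leeD2r.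
have mTK := measurableT_comp mhK (@measurable_iter_shiftT n).
apply: ae_ge0_le_integral => //.
- exact: (measurable_funS measurableT (@subsetT _ _) mTK).
- by move=> v _; exact: GeK0.
- exact: (measurable_funS measurableT (@subsetT _ _) mG').
(* The comparison with [h] is given only on [Vu x]; its complement is the exceptional null set. *)
exists (~` Vu x); split;
  [exact: measurableC (@measurable_Vu _ _ x)|exact: muc_notin_Vu|].
move=> v /= nv xv; apply: nv => wv.
by rewrite lee_fin addrA lerD2r; exact: hG.
Qed.

End Conditional.

(** * Regularity of the cocycle and the observable, and unstable diameters *)

Section Skew.
Context {R : realType} {M : markov_shift} {X : metricType R}.
Local Notation Sg := (Sigma R M).
Local Notation Sm := (Sminus R M).
Implicit Types (v w : Sg) (s t : X).

Lemma cvg_mdistP {Y : metricType R} {U : topologicalType} (f : U -> Y) (z : U) :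
  f y @[y --> z] --> f z <-> mdist (f z) (f y) @[y --> z] --> (0 : R).
Proof.
split=> [/metricType_numDomainType.cvgrPdist_lt fz|].
  apply/cvgrPdist_lt => e /fz; apply: filterS => y.
  by rewrite sub0r normrN ger0_norm ?mdist_ge0.
move=> /cvgrPdist_lt fz; apply/metricType_numDomainType.cvgrPdist_lt => e /fz.
by apply: filterS => y; rewrite sub0r normrN ger0_norm ?mdist_ge0.
Qed.

Lemma cvg_dist0 {U : topologicalType} (f : U -> R) (z : U) :
  `|f z - f y| @[y --> z] --> (0 : R) -> f y @[y --> z] --> f z.
Proof.
move=> /cvgrPdist_lt fz; apply/cvgrPdist_lt => e /fz; apply: filterS => y.
by rewrite sub0r normrN normr_id.
Qed.

Lemma cvg0_powR {T} {FF : set_system T} {FFF : Filter FF} (u : T -> R) (C a : R) :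
  0 < a -> (forall z, 0 <= u z) -> u @ FF --> (0 : R) ->
  C * u z `^ a @[z --> FF] --> (0 : R).
Proof.
move=> a0 u0 u_cvg; rewrite -[0 in X in _ --> X](mulr0 C).
apply: cvgM; first exact: cvg_cst.
apply/cvgrPdist_lt => e e0; have ea0 : 0 < e `^ a^-1 by rewrite powR_gt0.
move/cvgrPdist_lt : u_cvg => /(_ _ ea0); apply: filterS => z.
rewrite !sub0r !normrN !ger0_norm ?powR_ge0// => uz.
rewrite -[ltRHS](powRr1 (ltW e0)) -(mulVf (lt0r_neq0 a0)) powRrM.
by rewrite gt0_ltr_powR// nnegrE ?powR_ge0.
Qed.

Lemma holder_exp_ge0 {U V : Type} (dU : U -> U -> R) (dV : V -> V -> R)
    (a : R) (f : U -> V) : holder_exp dU dV a f ->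
  exists2 C : R, 0 <= C & forall x y, dV (f x) (f y) <= C * dU x y `^ a.
Proof.
move=> [C fC]; exists (Num.max C 0); first by rewrite le_max lexx orbT.
move=> x y; apply: le_trans (fC x y) _.
by rewrite ler_wpM2r ?powR_ge0// le_max lexx.
Qed.

(** The distance to a base point attains its maximum. This bound is what makes the suprema in
    [unif_dist] and [unstable_diam] genuine upper bounds, since [sup] has a default value on
    unbounded sets. *)
Lemma compact_mdist_bounded : compact [set: X] ->
  exists2 D : R, 0 <= D & forall s t, mdist s t <= D.
Proof.
move=> cX; have [[t0 _]|nX] := pselect ([set: X] !=set0); last first.
  by exists 0 => // s; absurd: nX; exists s.
have ct0 : continuous (mdist t0).
  move=> s; apply/cvgrPdist_lt => e e0.
  have /metricType_numDomainType.cvgrPdist_lt/(_ e e0) : t @[t --> s] --> s.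
    exact: cvg_id.
  apply: filterS => t; apply: le_lt_trans.
  have := metric_triangle t0 s t; have := metric_triangle t0 t s.
  by rewrite (metric_sym t s) ler_norml; lra.
have [c _ cM] := compact_EVT_max (ex_intro _ t0 I) cX (continuous_subspaceT ct0).
have {}cM s : mdist t0 s <= mdist t0 c by apply: cM; rewrite inE.
exists (mdist t0 c + mdist t0 c); first by rewrite addr_ge0 ?mdist_ge0.
move=> s t; apply: le_trans (metric_triangle s t0 t) _.
by rewrite lerD// metric_sym.
Qed.

Hypothesis compact_X : compact [set: X].
Variables (alpha : R) (F : Sg -> X -> X) (phi : Sg * X -> R).
Hypothesis F_holder : holder_cocycle alpha F.
Hypothesis phi_holder : holder prod_dist rdist phi.

Lemma mdist_unif_dist (f g : X -> X) t : mdist (f t) (g t) <= unif_dist f g.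
Proof.
have [D _ XD] := compact_mdist_bounded compact_X.
by apply: ub_le_sup; [exists D => _ [s _ <-]|exists t].
Qed.

Lemma iter_skew_map n w t :
  iter n (skew_map F) (w, t) = (iter n shiftT w, cocycle F n w t).
Proof. by elim: n => //= n ->. Qed.

(** By induction, with the triangle inequality through [F (T^n w)] applied to the orbit of [v]: one
    term is controlled by the Hölder fibre map, the other by the Hölder dependence of [F] on the
    base point. *)
Lemma continuous_cocycle n t : continuous (fun w => cocycle F n w t).
Proof.
have [/andP[a0 _] Fw [b /andP[b0 _] Fb]] := F_holder.
have [C2 C20 FC2] := holder_exp_ge0 Fb.
elim: n => [|n IHn] w; first exact: (@cst_continuous Sg X t w).
have [C1 C10 FC1] := holder_exp_ge0 (Fw (iter n shiftT w)).1.
apply: (cvg_mdistP _ _).2.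
apply: (@squeeze_cvgr _ (nbhs w) _ R (cst 0) (fun v =>
    C1 * mdist (cocycle F n w t) (cocycle F n v t) `^ alpha +
    C2 * mdist (iter n shiftT w) (iter n shiftT v) `^ b)).
- apply: nearW => v; rewrite mdist_ge0/=.
  apply: le_trans (metric_triangle _ (F (iter n shiftT w) (cocycle F n v t)) _) _.
  by rewrite lerD//; apply: le_trans (FC2 _ _); exact: mdist_unif_dist.
- exact: cvg_cst.
- rewrite -[0 in X in _ --> X](addr0 0); apply: cvgD.
    apply: (@cvg0_powR _ (nbhs w)) => // [v|]; first exact: mdist_ge0.
    exact: (cvg_mdistP _ _).1 (IHn w).
  apply: (@cvg0_powR _ (nbhs w)) => // [v|]; first exact: mdist_ge0.
  exact: (cvg_mdistP _ _).1 (@continuous_iter_shiftT R M n w).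
Qed.

Lemma continuous_phi_iter n t :
  continuous (fun w => phi (iter n (skew_map F) (w, t))).
Proof.
move=> w; have [b /andP[b0 _] phib] := phi_holder.
have [C C0 phiC] := holder_exp_ge0 phib.
apply: cvg_dist0.
apply: (@squeeze_cvgr _ (nbhs w) _ R (cst 0) (fun v =>
    C * (mdist (iter n shiftT w) (iter n shiftT v) +
         mdist (cocycle F n w t) (cocycle F n v t)) `^ b)).
- apply: nearW => v; rewrite normr_ge0/= !iter_skew_map.
  apply: le_trans (phiC _ _) _; rewrite ler_wpM2l// ge0_ler_powR ?(ltW b0)//.
  + by rewrite nnegrE le_max mdist_ge0.
  + by rewrite nnegrE addr_ge0 ?mdist_ge0.
  + by rewrite /prod_dist/= ge_max lerDl lerDr !mdist_ge0.
- exact: cvg_cst.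
- apply: (@cvg0_powR _ (nbhs w)) => // [v|].
    by rewrite addr_ge0 ?mdist_ge0.
  rewrite -[0 in X in _ --> X](addr0 0); apply: cvgD.
    exact: ((cvg_mdistP _ _).1 (@continuous_iter_shiftT R M n w)).
  exact: ((cvg_mdistP _ _).1 (@continuous_cocycle n t w)).
Qed.

Lemma measurable_continuous (G : Sg -> R) : continuous G ->
  measurable_fun [set: Sg] G.
Proof.
move=> /continuousP cG; apply: (measurability _ (RGenOpens.measurableE R)).
move=> _ [_ [a [b ->] <-]]; rewrite setTI; apply: measurable_open.
exact/cG/interval_open.
Qed.

Lemma measurable_phi_iter n t :
  measurable_fun [set: Sg] (fun w => phi (iter n (skew_map F) (w, t))).
Proof. by apply: measurable_continuous; exact: continuous_phi_iter. Qed.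

(** A Hölder function on a bounded space is bounded: the shift space has diameter at most [1], and
    [X] is compact. *)
Lemma phi_bounded : exists K : R, forall p, `|phi p| <= K.
Proof.
have [D D0 XD] := compact_mdist_bounded compact_X.
have [b /andP[b0 _] phib] := phi_holder.
have [C C0 phiC] := holder_exp_ge0 phib.
have [[t0 _]|nX] := pselect ([set: X] !=set0); last first.
  by exists 0 => -[v t]; absurd: nX; exists t.
have mdist_le1 v w : mdist v w <= 1.
  rewrite /mdist/= /sdist; have [->|nvw] := eqVneq (diff_weights v w) set0.
    by rewrite sup0.
  apply: ge_sup; first exact/set0P.
  by move=> _ [i _ <-]; rewrite exprn_ile1 ?invr_ge0// invf_le1 ?ler1n.
pose p0 : Sg * X := (point, t0).
exists (`|phi p0| + C * (1 + D) `^ b) => p.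
rewrite -lerBlDl; apply: le_trans (lerB_dist _ _) _.
apply: le_trans (phiC p p0) _; rewrite ler_wpM2l// ge0_ler_powR ?(ltW b0)//.
- by rewrite nnegrE le_max mdist_ge0.
- by rewrite nnegrE addr_ge0.
- rewrite /prod_dist ge_max; have := mdist_le1 p.1 point.
  by have := XD p.2 t0; lra.
Qed.

(** The sequence that [weak_unstable_holonomies] sends to [0]. *)
Definition unstable_diam (n : nat) : R :=
  sup [set d : R | exists t v w, same_past v w /\
    d = mdist (cocycle F n (iter n shiftTV v) t)
              (cocycle F n (iter n shiftTV w) t)].

Lemma mdist_cocycle_unstable n v w t :
  past (iter n shiftT v) = past (iter n shiftT w) ->
  mdist (cocycle F n v t) (cocycle F n w t) <= unstable_diam n.
Proof.
move=> /eq_pastP vw; have [D _ XD] := compact_mdist_bounded compact_X.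
apply: ub_le_sup; first by exists D => _ [s [a [b [_ ->]]]].
by exists t, (iter n shiftT v), (iter n shiftT w); rewrite !iter_shiftTK.
Qed.

Lemma unstable_diam_ge0 n : 0 <= unstable_diam n.
Proof.
have [[t _]|nX] := pselect ([set: X] !=set0); last first.
  rewrite /unstable_diam (_ : [set _ | _] = set0) ?sup0// -subset0.
  by move=> d [t _]; apply: nX; exists t.
apply: le_trans (mdist_ge0 _ _) _.
exact: (@mdist_cocycle_unstable n point point t erefl).
Qed.

End Skew.

(** * The pointwise bound and its Cesaro average *)

Theorem corollary8p14 (R : realType) (M : markov_shift) (X : metricType R)
  (compact_X : compact [set: X])
  (alpha : R) (F : Sigma R M -> X -> X) (phi : Sigma R M * X -> R)
  (psi : Sigma R M -> R) (psim : Sminus R M -> R)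
  (mu : probability (Sigma R M) R)
  (muc : Sminus R M -> probability (Sigma R M) R) (chi : R)
  (F_holder : holder_cocycle alpha F)
  (phi_holder : holder prod_dist rdist phi)
  (psi_holder : holder mdist rdist psi)
  (psi_past : forall w, psi w = psim (past w))
  (psi_pressure : pressure psi = 0)
  (psi_normalized : forall x, transfer psim (fun=> 1) x = 1)
  (mu_invariant : shift_invariant mu)
  (mu_gibbs : gibbs psi mu)
  (muc_cond : conditional_measures psim mu muc)
  (transitive_T : @topologically_transitive R M)
  (weak_hol : weak_unstable_holonomies F)
  (phi_hol : phi_holonomies F phi)
  (chi_gt0 : 0 < chi)
  (expanding : expanding_on_average phi muc chi) :
  (exists o : nat -> R, o @ \oo --> (0 : R) /\
     forall (x : Sminus R M) (n : nat),
       ((chi - o n)%:E <=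
          ereal_inf [set \int[muc x]_w (phi (iter n (skew_map F) (w, t)))%:E
                    | t in [set: X]])%E) /\
  (exists o : nat -> R, o @ \oo --> (0 : R) /\
     forall (x : Sminus R M) (n : nat), (0 < n)%N ->
       ((chi - o n)%:E <=
          ereal_inf [set \int[muc x]_w
              (n%:R^-1 * \sum_(0 <= j < n.+1) phi (iter j (skew_map F) (w, t)))%:E
                    | t in [set: X]])%E).

Proof.
have [b /andP[b0 _] phib] := phi_holder.
have [C C0 phiC] := holder_exp_ge0 phib.
have [K phiK] := phi_bounded compact_X phi_holder.
(* The Hölder modulus of [phi] evaluated at the unstable diameter. *)
pose o n := C * unstable_diam F n `^ b.
have o_ge0 n : 0 <= o n by rewrite mulr_ge0 ?powR_ge0.
have o_cvg : o @ \oo --> (0 : R).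
  by apply: cvg0_powR => // n; exact: unstable_diam_ge0.
have mphi n t := measurable_phi_iter compact_X F_holder phi_holder n t.
have phi_ge x n t :
    ((chi - o n)%:E <= \int[muc x]_w (phi (iter n (skew_map F) (w, t)))%:E)%E.
  apply: (@integral_muc_ge _ _ _ _ _ muc_cond x n _ K) => //; first exact: ltW.
  (* The fibre point is frozen at the image of [t] along the reference point [w] of the cylinder;
     expansion on average is then applied at the past of [T^n w]. *)
  move=> w xw; exists (fun v => phi (v, cocycle F n w t)); split => //.
  - exact: mphi 0%N _.
  - apply: le_trans (expanding _) _; apply: ereal_inf_lbound.
    by exists (cocycle F n w t).
  move=> v xv wv; rewrite iter_skew_map -lerBlDl.
  apply: le_trans (ler_norm _) _; apply: le_trans (phiC _ _) _.
  rewrite ler_wpM2l// ge0_ler_powR ?(ltW b0)// ?nnegrE ?unstable_diam_ge0//.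
    by rewrite le_max mdist_ge0.
  (* Both arguments of [phi] have base point [T^n v], so only the distance in the fibre remains. *)
  rewrite /prod_dist/= mdistxx ge_max unstable_diam_ge0//=.
  apply: mdist_cocycle_unstable => //.
  by apply: esym; apply: past_iter_shiftT wv; rewrite // xv xw.
split.
  exists o; split => // x n.
  by apply: le_ereal_inf_tmp => _ [t _ <-].
(* There are [n + 1] terms but the factor is [1/n], whereas the arithmetic mean divides by [n + 1];
   the [2] absorbs this, as [n + 1 <= 2 n] for [n >= 1]. *)
exists (fun n => 2 * arithmetic_mean o n); split.
  by rewrite -[0 in X in _ --> X](mulr0 2); apply: cvgM;
    [exact: cvg_cst|exact: cesaro].
move=> x n n_gt0; apply: le_ereal_inf_tmp => _ [t _ <-].
have phi_int j : (muc x).-integrable setT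
    (fun w => (phi (iter j (skew_map F) (w, t)))%:E).
  exact: (bounded_integrable _ (mphi j t) (fun w => phiK _)).
under eq_integral do rewrite EFinM -sumEFin.
rewrite integralZl//; last exact: integrable_sum.
rewrite integral_sum//.
apply: (@le_trans _ _ (n%:R^-1%:E * \sum_(0 <= j < n.+1) (chi - o j)%:E)%E);
  last first.
  apply: lee_wpmul2l; first by rewrite lee_fin invr_ge0.
  by apply: lee_sum => j _; exact: phi_ge.
rewrite sumEFin -EFinM lee_fin sumrB sumr_const_nat subn0.
rewrite /arithmetic_mean/= /series/=; set S := \sum_(_ <= _ < _) _.
have S0 : 0 <= S by exact: sumr_ge0.
have n0 : 0 < n%:R :> R by rewrite ltr0n.
have n1 : 1 <= n%:R :> R by rewrite ler1n.
(* The surplus term only helps here, because [chi] is positive. *)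
have chi_le : chi <= n%:R^-1 * (chi *+ n.+1).
  rewrite -[chi *+ _]mulr_natr mulrCA ler_peMr ?(ltW chi_gt0)//.
  by rewrite mulrC ler_pdivlMr// mul1r ler_nat.
have S_le : n%:R^-1 * S <= 2 * (n.+1%:R^-1 * S).
  rewrite mulrA ler_wpM2r// ler_pdivlMr// mulrC ler_pdivrMr// -natr1; lra.
by rewrite mulrBr lerB.
Qed.
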